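(* Let $Q=\{1,2,\ldots,n\}$ be a left cancellative groupoid which is $k$-translatable (with respect to the natural ordering $1,2,\ldots,n$), with $k$-translatable sequence $a_1,a_2,\ldots,a_n$. Then $Q$ is a semigroup if and only if $[k^2+k]_n=0$ and $a_i=[i-k-ka_k]_n$ for all $i=1,2,\ldots,n$.
   Context: A groupoid is a set with a binary operation $\cdot$. It is left cancellative if $x\cdot y=x\cdot z$ implies $y=z$. A semigroup is an associative groupoid. For an integer $x$, $[x]_n$ denotes the residue of $x$ modulo $n$, represented by an element of $\{1,\ldots,n\}$, with the convention that $0$ is identified with $n$; so $[x]_n=[y]_n$ means $x\equiv y\pmod n$, and $[x]_n=0$ means $n\mid x$. For $1\le k<n$, a groupoid $Q=\{1,\ldots,n\}$ is $k$-translatable (with respect to the natural ordering) if in its multiplication table each row $i$, $2\le i\le n$, is obtained from row $i-1$ by cyclically shifting it $k$ places to the right, i.e. $i\cdot j=(i-1)\cdot[j-k]_n$ for all $j$ and all $2\le i\le n$. The first row $a_j=1\cdot j$ ($j=1,\ldots,n$) is then the $k$-translatable sequence of $Q$. *)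

(* Defs.v *)
From HB Require Import structures.
From mathcomp Require Import all_boot all_order all_algebra.

Set Implicit Arguments.
Unset Strict Implicit.
Unset Printing Implicit Defensive.

Import GRing.Theory Num.Theory.

(* The underlying set {1, ..., n}; note that the least element is 1, unlike in
   'I_n. *)
Record interval1 (n : nat) :=
  Interval1 { interval1_val :> nat; _ : (0 < interval1_val <= n)%N }.

HB.instance Definition _ n := [isSub for @interval1_val n].
HB.instance Definition _ n := [Countable of interval1 n by <:].

Definition residue_nat (n : nat) (x : int) : nat :=
  if (n %| x)%Z then n else `|(x %% n)%Z|%N.

Lemma residue_nat_bounds (n : nat) (x : int) :
  (0 < n)%N -> (0 < residue_nat n x <= n)%N.
Proof.
move=> n_gt0; rewrite /residue_nat; case: ifPn => [_|Hx].
  by rewrite n_gt0 leqnn.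
have n_neq0 : (n : int) != 0%R by rewrite -lt0n in n_gt0 *; case: n n_gt0 {Hx}.
have x_ge0 := modz_ge0 x n_neq0.
rewrite absz_gt0; apply/andP; split.
  by apply: contra Hx => /eqP Hx; apply/dvdz_mod0P.
by rewrite -lez_nat gez0_abs // Order.POrderTheory.ltW // ltz_pmod.
Qed.

(* [x]_n, the representative of x modulo n in {1, ..., n}; in particular [0]_n
   is n. *)
Definition residue (n : nat) (n_gt0 : (0 < n)%N) (x : int) : interval1 n :=
  Interval1 (residue_nat_bounds x n_gt0).

Definition left_cancellative (T : Type) (mul : T -> T -> T) : Prop :=
  forall x y z : T, mul x y = mul x z -> y = z.

(* For i >= 2 the residue of i - 1 is i - 1 itself. *)
Definition translatable (n : nat) (n_gt0 : (0 < n)%N) (k : nat)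
    (mul : interval1 n -> interval1 n -> interval1 n) : Prop :=
  forall i j : interval1 n, (2 <= i)%N ->
    mul i j = mul (residue n_gt0 (i%:Z - 1)%R) (residue n_gt0 (j%:Z - k%:Z)%R).

Definition translatable_sequence (n : nat) (n_gt0 : (0 < n)%N)
    (mul : interval1 n -> interval1 n -> interval1 n) (j : interval1 n) :
    interval1 n :=
  mul (residue n_gt0 1%:Z) j.

(* Main.v *)
Require Import Defs.
From mathcomp Require Import all_boot all_order all_algebra.
From mathcomp Require Import zify ring.

(** Everything becomes transparent once the operation is written over the ring
    of residues modulo [n].  Going from one row to the next shifts by [k], so
    the whole table is governed by its first row [f]:
        x . y = f (y - k x + k)
    ([mul_translate]).  Left cancellation makes [f] injective, so [f] can be
    stripped from both sides of the associative law, which leaves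
        f (z - k y + k) = z + k x - k f (y - k x + k)  for all x, y, z.
    Here the left side does not involve [x]: choosing [x] and [y] suitably
    forces [f] to be the translation [z |-> z - k - k f(k)], and then
    [k ^ 2 + k = 0].  The converse is a computation ([translate_assocP]).
    What remains is to transport this along the bijection between
    [{1, ..., n}] and the ring of residues. *)

Set Implicit Arguments.
Unset Strict Implicit.
Unset Printing Implicit Defensive.

Import GRing.Theory.
Local Open Scope ring_scope.

Section TranslateOperation.

Variables (R : comNzRingType) (k : R) (f : R -> R).

Definition translate_op (x y : R) : R := f (y - k * x + k).

(** Since [k ^ 2 = - k], the constant [d = k * f k] satisfies [k * d = - d];
    this is what makes the constant terms of the two bracketings agree. *)
Lemma translate_op_assoc :
  k ^+ 2 + k = 0 -> (forall z, f z = z - k - k * f k) ->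
  associative translate_op.
Proof.
move=> kk0 fE x y z; rewrite /translate_op !(fE (_ + k)).
set d := f k; apply/eqP; rewrite -subr_eq0; apply/eqP.
have -> : z - k * y + k - k - k * d - k * x + k - k - k * d -
   (z - k * (y - k * x + k - k - k * d) + k - k - k * d)
   = - (k ^+ 2 + k) * (x + d) by ring.
by rewrite kk0 oppr0 mul0r.
Qed.

Lemma assoc_translate_op : injective f -> associative translate_op ->
  k ^+ 2 + k = 0 /\ forall z, f z = z - k - k * f k.
Proof.
move=> f_inj opA.
have key x y z : f (z - k * y + k) = z + k * x - k * f (y - k * x + k).
  have := f_inj _ _ (opA x y z); rewrite /translate_op => E.
  have -> : f (z - k * y + k) = f (z - k * y + k) - k * x + k + (k * x - k)
    by ring.
  by rewrite E; ring.
(* With [x = y = 0] the inner [f] is evaluated at [k], the outer at [z + k]. *)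
have fE z : f z = z - k - k * f k.
  have := key 0 0 (z - k).
  by rewrite !mulr0 subr0 addr0 sub0r oppr0 add0r subrK.
split=> //.
(* Taking [y = k * x] keeps the argument of the inner [f] equal to [k] while [x]
   varies; comparing with [fE] gives [(k ^ 2 + k) * x = 0], here for [x = 1]. *)
have := key 1 k 0; rewrite mulr1 subrr !add0r {1}fE => /eqP.
rewrite -subr_eq0 => /eqP E; apply/eqP; rewrite -oppr_eq0 -E; apply/eqP.
by ring.
Qed.

Lemma translate_assocP : injective f ->
  associative translate_op <->
  k ^+ 2 + k = 0 /\ forall z, f z = z - k - k * f k.
Proof.
move=> f_inj; split; first exact: assoc_translate_op.
by case; apply: translate_op_assoc.
Qed.

End TranslateOperation.

Section ResidueClasses.

Variables (n : nat) (n_gt0 : (0 < n)%N) (n_gt1 : (1 < n)%N).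

Definition class_of (i : interval1 n) : 'Z_n := i%:R.

Definition representative (z : 'Z_n) : interval1 n := residue n_gt0 (z : nat).

Lemma class_of_residue (x : int) : class_of (residue n_gt0 x) = x%:~R.
Proof.
have n0 : n%:R = 0 :> 'Z_n by exact: pchar_Zp.
have xE : x%:~R = (x %% n)%Z%:~R :> 'Z_n.
  by rewrite {1}(divz_eq x n) rmorphD rmorphM /= -[n%:~R]/(n%:R) n0 mulr0 add0r.
rewrite /class_of /= /residue_nat; case: ifPn => [/dvdz_mod0P x0|_].
  by rewrite xE x0.
rewrite xE -[LHS]/(_%:Z%:~R) gez0_abs // modz_ge0 //; lia.
Qed.

Lemma class_of_inj : injective class_of.
Proof.
move=> i j; rewrite /class_of => /(congr1 val) /=.
rewrite !val_Zp_nat // => ij; apply: val_inj => /=.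
case: i j ij => i /= /andP[i0 iN] [j /= /andP[j0 jN]] ij.
have modE m : (m <= n)%N -> (m %% n)%N = (if m == n then 0 else m)%N.
  by rewrite leq_eqVlt; case: eqP => [-> _|_ /modn_small]; rewrite ?modnn.
by move: ij; rewrite !modE //; do 2![case: eqP => ?]; lia.
Qed.

Lemma representativeK : cancel representative class_of.
Proof. by move=> z; rewrite /representative class_of_residue -pmulrn natr_Zp. Qed.

Lemma class_ofK : cancel class_of representative.
Proof. by move=> i; apply: class_of_inj; rewrite representativeK. Qed.

Lemma residueE (x : int) : residue n_gt0 x = representative x%:~R.
Proof. by apply: class_of_inj; rewrite representativeK class_of_residue. Qed.

Variables (k : nat) (mul : interval1 n -> interval1 n -> interval1 n).
Hypothesis mul_trans : translatable n_gt0 k mul.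

(** The first row determines the table: row [i] is the first row after [i - 1]
    shifts by [k].  The rule for passing between consecutive rows does not link
    row [n] back to row [1], so the induction is on the number [i] and not on
    its class. *)
Lemma mul_translate (i j : interval1 n) :
  mul i j = mul (residue n_gt0 1)
                (representative (class_of j - k%:R * class_of i + k%:R)).
Proof.
move: {2}(val i) (erefl (val i)) => m im.
elim: m i j im => [|m IHm] i j im.
  by have := valP i; rewrite im.
case: m IHm im => [|m] IHm im.
  have -> : i = residue n_gt0 1.
    by apply: class_of_inj; rewrite class_of_residue /class_of im.
  by rewrite class_of_residue mulr1 subrK class_ofK.
have im1 : val (residue n_gt0 (i%:Z - 1)) = m.+1.
  have mn : (0 < m.+1 <= n)%N by have := valP i; rewrite im => /andP[_ /ltnW].
  rewrite -[RHS]/(val (Interval1 mn)); congr val; apply: class_of_inj.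
  by rewrite class_of_residue /class_of im rmorphB /= -natrB // subn1.
rewrite mul_trans; last by rewrite im.
rewrite (IHm _ _ im1) !class_of_residue !rmorphB /=.
rewrite -[i%:~R]/(class_of i) -[j%:~R]/(class_of j) -[k%:~R]/(k%:R : 'Z_n).
congr (mul _ (representative _)); ring.
Qed.

Definition first_row (z : 'Z_n) : 'Z_n :=
  class_of (translatable_sequence n_gt0 mul (representative z)).

Lemma class_of_mul (i j : interval1 n) :
  class_of (mul i j) = translate_op k%:R first_row (class_of i) (class_of j).
Proof. by rewrite mul_translate. Qed.

Lemma mul_assoc_class :
  associative mul <-> associative (translate_op k%:R first_row).
Proof.
split=> mulA x y z.
  rewrite -[x]representativeK -[y]representativeK -[z]representativeK.
  by rewrite -!class_of_mul mulA.
by apply: class_of_inj; rewrite !class_of_mul mulA.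
Qed.

Lemma first_row_inj : left_cancellative mul -> injective first_row.
Proof.
move=> mul_cancel x y /class_of_inj /mul_cancel.
exact: (can_inj representativeK).
Qed.

End ResidueClasses.

Theorem theorem5p1 (n k : nat) (n_gt0 : (0 < n)%N) (k_gt0 : (0 < k)%N)
    (k_lt_n : (k < n)%N) (mul : interval1 n -> interval1 n -> interval1 n)
    (mul_cancel : left_cancellative mul) (mul_trans : translatable n_gt0 k mul)
    (a : interval1 n -> interval1 n)
    (a_seq : forall j : interval1 n, a j = translatable_sequence n_gt0 mul j) :
  associative mul <->
  residue n_gt0 (k ^ 2 + k)%N%:Z = residue n_gt0 0%:Z /\
  forall i : interval1 n,
    a i = residue n_gt0
            (i%:Z - k%:Z - k%:Z * (a (residue n_gt0 k%:Z))%:Z)%R.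
Proof.
(* ['Z_n] is the ring of residues modulo [n] only when [1 < n]. *)
have n_gt1 : (1 < n)%N by apply: leq_ltn_trans k_lt_n.
have c_inj := @class_of_inj n n_gt0 n_gt1.
apply: (iff_trans (mul_assoc_class n_gt1 mul_trans)).
have row_inj := @first_row_inj _ n_gt0 n_gt1 _ mul_cancel.
apply: (iff_trans (translate_assocP _ row_inj)).
have rowE z : first_row n_gt0 mul z = class_of (a (representative n_gt0 z)).
  by rewrite a_seq.
have kE : class_of (residue n_gt0 (k ^ 2 + k)%N%:Z) = k%:R ^+ 2 + k%:R.
  by rewrite class_of_residue // -natrX -natrD.
have zeroE : class_of (residue n_gt0 0%:Z) = 0 by rewrite class_of_residue.
have aE (i : interval1 n) : class_of (residue n_gt0
      (i%:Z - k%:Z - k%:Z * (a (residue n_gt0 k%:Z))%:Z)) =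
    class_of i - k%:R - k%:R * first_row n_gt0 mul k%:R.
  by rewrite class_of_residue // rowE !rmorphB rmorphM /= (residueE _ n_gt1 k).
split=> -[kk0 rowT]; split.
- by apply: c_inj; rewrite kE zeroE.
- by move=> i; apply: c_inj; rewrite aE -rowT rowE class_ofK.
- by rewrite -kE -zeroE kk0.
- by move=> z; rewrite {1}rowE rowT aE representativeK.
Qed.
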